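(* Let $G$ be a finite abelian group, let $A\subseteq G$ be a set of density $\alpha=|A|/|G|>0$, and let $\varepsilon\in(0,1)$. Then there exist an integer $r\ge 0$ with $$r\le \frac{2}{\varepsilon^2}\log\frac1\alpha,$$ a dissociated set $\Delta\subseteq \widehat G$ with $|\Delta|=r$, and functions $g_\sigma:G\to[0,\infty)$, indexed by $\sigma\in\Sigma_r=\{\pm1\}^r$, such that all of the following hold: (i) for every $\sigma\in\Sigma_r$, $\mathbb E_{x\in G}\, g_\sigma(x)=1$ and $\operatorname{supp}\widehat{g_\sigma}\subseteq \langle\Delta\rangle$; (ii) for every $x\in G$, $\mathbb E_{\sigma\in\Sigma_r}\, g_\sigma(x)=1$; (iii) for every $\eta\in\widehat G$ with $\eta\notin\langle\Delta\rangle$, $$\mathbb E_{\sigma\in\Sigma_r}\left|\mathbb E_{x\sim\mu_A}\, g_\sigma(x)\,\overline{\eta(x)}\right|\le \varepsilon .$$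
   Context: $G$ is written additively. $\widehat G$ is its dual group (the group of characters $\xi:G\to\mathbb C^\times$), also written additively, so $(\xi+\eta)(x)=\xi(x)\eta(x)$ and $0\in\widehat G$ is the trivial character. For a finite set $\Lambda\subseteq\widehat G$, its $\{-1,0,1\}$-span is $$\langle\Lambda\rangle=\left\{\sum_{\lambda\in\Lambda}\eta_\lambda\lambda:\ \eta_\lambda\in\{-1,0,1\}\right\}$$ (so $\langle\varnothing\rangle=\{0\}$). A finite set $\Lambda\subseteq\widehat G$ is dissociated if the only relation $\sum_{\lambda\in\Lambda}\eta_\lambda\lambda=0$ with all $\eta_\lambda\in\{-1,0,1\}$ is the one in which all $\eta_\lambda$ vanish. For $f:G\to\mathbb C$ and $\xi\in\widehat G$, $\widehat f(\xi)=\mathbb E_{x\in G}f(x)\overline{\xi(x)}$, and $\operatorname{supp}\widehat f=\{\xi\in\widehat G:\widehat f(\xi)\ne 0\}$. $\mathbb E_{s\in S}$ denotes the uniform average over a finite non-empty set $S$. $\mu_A$ is the uniform probability measure on $A$, so $\mathbb E_{x\sim\mu_A}f(x)=\frac{1}{|A|}\sum_{x\in A}f(x)$. By convention $\Sigma_0=\{\varnothing\}$ is a one-element set. $\log$ is the natural logarithm. *)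

(* Defs.v *)
From HB Require Import structures.
From mathcomp Require Import all_boot all_order all_algebra finmap complex.
From mathcomp Require Import classical_sets reals exp.

Set Implicit Arguments.
Unset Strict Implicit.
Unset Printing Implicit Defensive.

Import Order.TTheory GRing.Theory Num.Theory.
Local Open Scope ring_scope.
Local Open Scope complex_scope.

Definition avg (T : finType) (F : fieldType) (S : {set T}) (f : T -> F) : F :=
  (\sum_(x in S) f x) / #|S|%:R.

Notation "''E_' ( x 'in' S ) f" := (avg S (fun x => f))
  (at level 36, f at level 36, x binder, S at level 50,
   format "''E_' ( x  'in'  S )  f") : ring_scope.

(* {+1,-1}^r; as usual in MathComp a boolean b stands for the sign (-1) ^+ b. *)
Notation signs r := {ffun 'I_r -> bool}.

Section Dual.
Variables (G : finZmodType) (R : realType).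

Definition is_character (chi : {ffun G -> R[i]}) : bool :=
  [forall x, chi x != 0] && [forall x, forall y, chi (x + y) == chi x * chi y].

Record dual_group := Dual { char_ffun :> {ffun G -> R[i]}; _ : is_character char_ffun }.

HB.instance Definition _ := [isSub for char_ffun].
HB.instance Definition _ := [Choice of dual_group by <:].

Lemma char_neq0 (xi : dual_group) x : xi x != 0.
Proof. by case: xi => chi /= /andP[/forallP + _]; apply. Qed.

Lemma charD (xi : dual_group) x y : xi (x + y) = xi x * xi y.
Proof. by case: xi => chi /= /andP[_ /forallP/(_ x)/forallP/(_ y)/eqP]. Qed.

Lemma dualP (xi eta : dual_group) : (forall x, xi x = eta x) -> xi = eta.
Proof. by move=> h; apply/val_inj/ffunP. Qed.

Fact dual_zero_subproof : is_character [ffun=> 1].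
Proof.
apply/andP; split; apply/forallP => x; rewrite ?ffunE ?oner_neq0 //.
by apply/forallP => y; rewrite !ffunE mulr1.
Qed.

Fact dual_opp_subproof (xi : dual_group) : is_character [ffun x => (xi x)^-1].
Proof.
apply/andP; split; apply/forallP => x; first by rewrite ffunE invr_neq0 ?char_neq0.
by apply/forallP => y; rewrite !ffunE charD invfM.
Qed.

Fact dual_add_subproof (xi eta : dual_group) : is_character [ffun x => xi x * eta x].
Proof.
apply/andP; split; apply/forallP => x; first by rewrite ffunE mulf_neq0 ?char_neq0.
by apply/forallP => y; rewrite !ffunE !charD mulrACA.
Qed.

Definition dual_zero := Dual dual_zero_subproof.
Definition dual_opp xi := Dual (dual_opp_subproof xi).
Definition dual_add xi eta := Dual (dual_add_subproof xi eta).

Fact dual_addA : associative dual_add.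
Proof. by move=> a b c; apply: dualP => x; rewrite !ffunE mulrA. Qed.

Fact dual_addC : commutative dual_add.
Proof. by move=> a b; apply: dualP => x; rewrite !ffunE mulrC. Qed.

Fact dual_add0 : left_id dual_zero dual_add.
Proof. by move=> a; apply: dualP => x; rewrite !ffunE mul1r. Qed.

Fact dual_addN : left_inverse dual_zero dual_opp dual_add.
Proof. by move=> a; apply: dualP => x; rewrite !ffunE mulVf ?char_neq0. Qed.

HB.instance Definition _ :=
  GRing.isZmodule.Build dual_group dual_addA dual_addC dual_add0 dual_addN.

Definition sign_coefs (L : {fset dual_group}) (e : dual_group -> int) : Prop :=
  forall l, l \in L -> e l \in [:: -1; 0; 1].

Definition sign_span (L : {fset dual_group}) : set dual_group :=
  [set xi | exists2 e : dual_group -> int,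
              sign_coefs L e & xi = \sum_(l <- L) l *~ e l]%classic.

Definition dissociated (L : {fset dual_group}) : Prop :=
  forall e : dual_group -> int, sign_coefs L e ->
    \sum_(l <- L) l *~ e l = 0 -> forall l, l \in L -> e l = 0.

Definition fourier (f : G -> R[i]) (xi : dual_group) : R[i] :=
  'E_(x in [set: G]) (f x * (xi x)^*).

Definition fourier_supp (f : G -> R[i]) : set dual_group :=
  [set xi | fourier f xi != 0]%classic.

End Dual.

(* Main.v *)
(* The set D and the functions g_s are built greedily. Suppose eta, outside the span of
   D, violates (iii). Add eta to D and split each g_s into g_s (1 +- Re (u_s conj eta)),
   where the unimodular u_s turns c_s = E_A (g_s conj eta) into |c_s|. The weights w_s =
   E_A g_s then split into w_s +- |c_s|, and this raises the entropy E_s (w_s ln w_s) by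
   at least epsilon^2 / 2. The entropy starts at 0 and never exceeds ln (1 / alpha),
   because E_s w_s = 1 and w_s <= (E_G g_s) / alpha = 1 / alpha, so the process stops in
   time. *)

Require Import Defs.
From mathcomp Require Import all_boot all_order all_algebra finmap complex.
From mathcomp Require Import classical_sets reals exp.
From mathcomp Require Import fingroup boolp topology normedtype sequences derive ring lra.

Import Order.TTheory GRing.Theory Num.Theory.
Import numFieldNormedType.Exports.
Local Open Scope ring_scope.
Local Open Scope complex_scope.

(** * Growth of [x ln x] under a symmetric split *)

Section Entropy.
Variable R : realType.
Implicit Types (x y e w t : R) (f df : R -> R).

Lemma derive_ge0_le f df :
    (forall x, is_derive x 1 f (df x)) -> (forall x, 0 <= x -> 0 <= df x) ->
  forall x, 0 <= x -> f 0 <= f x.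
Proof.
move=> fdf df_ge0 x; rewrite le_eqVlt => /predU1P[<- //|x_gt0].
have fcont y : {for y, continuous f}.
  by apply/differentiable_continuous/derivable1_diffP; apply: ex_derive.
have [|c + fxE] := @MVT _ f df 0 x x_gt0 (fun y _ => fdf y).
  exact/continuous_subspaceT.
rewrite in_itv /= => /andP[c_gt0 _].
by rewrite -subr_ge0 fxE subr0 mulr_ge0 ?df_ge0 ?ltW.
Qed.

(** This is [cosh x <= exp (x^2 / 2)]. It holds because the quotient of the two sides is
    nonincreasing for [x >= 0]; [q] below is minus twice that quotient. *)
Lemma expRD_expRN_le x : 0 <= x ->
  expR x + expR (- x) <= 2 * expR (x ^+ 2 / 2).
Proof.
move=> x_ge0.
(* [p] carries the sign of the derivative of [q]; its own derivative is visibly nonnegative on the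
   half-line. *)
pose p x := expR (- x) * (1 + x) - expR x * (1 - x).
have p_ge0 y : 0 <= y -> 0 <= p y.
  have p0 : p 0 = 0 by rewrite /p oppr0 expR0; ring.
  rewrite -{2}p0; apply: (@derive_ge0_le _ (fun x => x * (expR x - expR (- x)))).
    move=> z; rewrite /p; apply: is_derive_eq; rewrite /GRing.scale/=; ring.
  by move=> z z0; rewrite mulr_ge0// subr_ge0 ler_expR; lra.
pose q x := - (expR (- (x ^+ 2 / 2)) * (expR x + expR (- x))).
suff : q 0 <= q x.
  rewrite /q expr0n /= mul0r oppr0 !expR0 !mul1r lerN2 expRN mulrC.
  by rewrite ler_pdivrMr ?expR_gt0.
apply: (@derive_ge0_le _ (fun x => expR (- (x ^+ 2 / 2)) * p x)) x_ge0.
  move=> z; rewrite /q /p; apply: is_derive_eq; rewrite /GRing.scale/=; by field.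
by move=> z z0; rewrite mulr_ge0 ?expR_ge0 ?p_ge0.
Qed.

(* The tangent line of [x ln x] at [x = exp a]. *)
Lemma xlnx_ge x a : 0 <= x -> x * a + x - expR a <= x * ln x.
Proof.
rewrite le_eqVlt => /predU1P[<-|x_gt0].
  by have := expR_ge0 a; rewrite !mul0r; lra.
have : 1 + (a - ln x) <= expR (a - ln x) by exact: expR_ge1Dx.
rewrite expRD expRN lnK ?posrE// ler_pdivlMr//; nra.
Qed.

(* Both tangents are taken at the optimal points [w exp(+-e) / cosh e]. *)
Lemma xlnx_split w t e : 0 <= e -> 0 <= t <= w ->
  2 * (w * ln w) + 2 * e * t - e ^+ 2 * w
    <= (w + t) * ln (w + t) + (w - t) * ln (w - t).
Proof.
move=> e_ge0 /andP[t_ge0 tw].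
have [w_le0|w_gt0] := leP w 0.
  have [-> ->] : w = 0 /\ t = 0 by split; lra.
  by rewrite addr0 subr0 !mul0r; lra.
pose c := (expR e + expR (- e)) / 2.
have c_gt0 : 0 < c by have := expR_gt0 e; have := expR_gt0 (- e); rewrite /c; lra.
have lnc : ln c <= e ^+ 2 / 2.
  rewrite -ler_expR lnK ?posrE//.
  by have := expRD_expRN_le _ e_ge0; rewrite /c; lra.
have tangent s : expR (ln w - ln c + s) = w / c * expR s.
  by rewrite !expRD expRN !lnK ?posrE.
have wt : 0 <= w + t by lra.
have wt' : 0 <= w - t by lra.
have := xlnx_ge _ (ln w - ln c + e) wt.
have := xlnx_ge _ (ln w - ln c - e) wt'.
rewrite !tangent => h1 h2.
(* The exponential terms of the two tangents cancel their linear terms, so the only loss is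
   [2 * w * ln c]. *)
have h3 : w / c * expR e + w / c * expR (- e) = 2 * w.
  rewrite -mulrDr (_ : _ + _ = 2 * c); last by rewrite /c; lra.
  by field; rewrite gt_eqF.
nra.
Qed.

End Entropy.

(** * Averages over finite sets and over sign vectors *)

Section Averages.
Context {T : finType} {F : fieldType}.
Implicit Types (S : {set T}) (f g : T -> F).

Lemma avgD S f g : 'E_(x in S) (f x + g x) = avg S f + avg S g.
Proof. by rewrite /avg big_split mulrDl. Qed.

Lemma avgZ S a f : 'E_(x in S) (a * f x) = a * avg S f.
Proof. by rewrite /avg -mulr_sumr mulrA. Qed.

Lemma eq_avg S f g : f =1 g -> avg S f = avg S g.
Proof. by move=> fg; rewrite /avg; congr (_ / _); apply: eq_bigr. Qed.

End Averages.

Section RealAverages.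
Context {T : finType} {F : numFieldType}.
Implicit Types (S : {set T}) (f g : T -> F).

Lemma avg_cst S (a : F) : (0 < #|S|)%N -> 'E_(x in S) a = a.
Proof.
by move=> S_gt0; rewrite /avg sumr_const -[X in X / _]mulr_natr mulfK// pnatr_eq0 -lt0n.
Qed.

Lemma le_avg S f g : (forall x, x \in S -> f x <= g x) -> avg S f <= avg S g.
Proof. by move=> fg; rewrite ler_wpM2r ?invr_ge0 ?ler0n ?ler_sum. Qed.

Lemma avg_ge0 S f : (forall x, x \in S -> 0 <= f x) -> 0 <= avg S f.
Proof. by move=> f_ge0; rewrite mulr_ge0 ?invr_ge0 ?ler0n ?sumr_ge0. Qed.

Lemma avg_exchange (T' : finType) (S : {set T}) (S' : {set T'}) (f : T -> T' -> F) :
  'E_(x in S) 'E_(y in S') f x y = 'E_(y in S') 'E_(x in S) f x y.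
Proof.
rewrite /avg -!mulr_suml exchange_big /= -!mulrA; congr (_ * _); exact: mulrC.
Qed.

Lemma card_signs_gt0 r : (0 < #|[set: signs r]|)%N.
Proof. by rewrite cardsT card_ffun card_bool expn_gt0. Qed.

Definition signs_behead r (s : signs r.+1) : signs r := [ffun i => s (lift ord0 i)].

(** Peeling off the first sign, the one added last by the greedy step, lets stage [r.+1] be compared
    with stage [r]. *)
Lemma avg_signsS r (f : signs r -> bool -> F) :
  'E_(s in [set: signs r.+1]) f (signs_behead r s) (s ord0)
    = 'E_(s in [set: signs r]) ((f s false + f s true) / 2).
Proof.
rewrite /avg -mulr_suml !cardsT !card_ffun card_bool !card_ord expnS natrM invfM mulrA.
have sumT (I : finType) (h : I -> F) : \sum_(x in [set: I]) h x = \sum_x h x.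
  by apply: eq_bigl => x; rewrite inE.
congr (_ / _ / _); rewrite !sumT.
pose cons (p : signs r * bool) : signs r.+1 :=
  [ffun i => if unlift ord0 i is Some j then p.1 j else p.2].
have consK s : cons (signs_behead r s, s ord0) = s.
  by apply/ffunP => i; rewrite ffunE; case: unliftP => [j|] ->; rewrite ?ffunE.
have Kcons p : (signs_behead r (cons p), cons p ord0) = p.
  case: p => s b; rewrite /cons ffunE unlift_none; congr (_, _).
  by apply/ffunP => i; rewrite !ffunE liftK.
have hcons b s : f (signs_behead r (cons (s, b))) (cons (s, b) ord0) = f s b.
  by case: (Kcons (s, b)) => -> ->.
rewrite (reindex cons) /=; last first.
  by exists (fun s => (signs_behead r s, s ord0)) => p _; rewrite ?consK ?Kcons.
rewrite (eq_bigr (fun p => f p.1 p.2)) => [|[s b] _]; last exact: hcons.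
rewrite -(pair_bigA _ f) /=.
by apply: eq_bigr => s _; rewrite big_bool /= addrC.
Qed.

End RealAverages.

(** * Characters, their twists, and spans with coefficients -1, 0, 1 *)

Section Characters.
Variables (R : realType) (G : finZmodType).
Implicit Types (xi eta : dual_group G R) (g : G -> R) (S : {set G}) (u : R[i]).
Implicit Type D : {fset dual_group G R}.

Lemma complex_natr n : n%:R%:C = n%:R :> R[i].
Proof. by rewrite rmorph_nat. Qed.

Lemma ReD (z t : R[i]) : complex.Re (z + t) = complex.Re z + complex.Re t.
Proof. by case: z; case: t. Qed.

Lemma ReMr (z : R[i]) (a : R) : complex.Re (z * a%:C) = complex.Re z * a.
Proof. by case: z => b c; rewrite /= mulr0 subr0. Qed.

Lemma Re_avg (T : finType) (S : {set T}) (f : T -> R[i]) :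
  complex.Re (avg S f) = 'E_(x in S) complex.Re (f x).
Proof.
rewrite /avg -complex_natr -fmorphV ReMr; congr (_ / _).
exact: (big_morph _ ReD (erefl : complex.Re (0 : R[i]) = 0)).
Qed.

Lemma avg_real (T : finType) (S : {set T}) (f : T -> R) :
  (avg S f)%:C = 'E_(x in S) (f x)%:C.
Proof. by rewrite /avg rmorphM fmorphV rmorph_nat rmorph_sum. Qed.

Lemma char0 xi : xi 0 = 1.
Proof. by apply: (mulfI (char_neq0 xi 0)); rewrite -charD addr0 mulr1. Qed.

(** Elements of [G] have finite order, so [xi x] is a root of unity. *)
Lemma norm_char xi x : `|xi x| = 1.
Proof.
have charMn n : xi (x *+ n) = xi x ^+ n.
  by elim: n => [|n IHn]; rewrite ?mulr0n ?char0// mulrS exprS charD IHn.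
have : xi x ^+ #[x]%g = 1 by rewrite -charMn -FinRing.zmodXgE expg_order char0.
move/(congr1 Num.norm); rewrite normrX normr1 => /eqP.
by rewrite pexpr_eq1 ?normr_ge0 ?order_gt0// => /eqP.
Qed.

Lemma conj_char xi x : (xi x)^*%R = (xi x)^-1.
Proof.
apply: (mulfI (char_neq0 xi x)).
by rewrite -normCK norm_char expr1n divff ?char_neq0.
Qed.

(** Translation by [y] multiplies the character sum by the conjugate of [xi y], so the sum vanishes
    as soon as some [xi y] differs from 1. *)
Lemma fourier_cst1 xi : fourier (fun=> 1) xi != 0 -> xi = 0.
Proof.
move=> nz; apply: dualP => y; rewrite ffunE; apply/eqP; apply: contraNT nz => xiy.
rewrite /fourier /avg mulf_eq0; apply/orP; left.
set s := \sum_(x in _) _.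
have : s = (xi y)^* * s.
  rewrite {1}/s mulr_sumr (reindex_inj (addIr y)) /=.
  apply: eq_big => [x|x _]; first by rewrite !inE.
  by rewrite charD rmorphM !mul1r mulrC.
move/eqP; rewrite eq_sym -subr_eq0 -{2}[s]mul1r -mulrBl mulf_eq0 subr_eq0.
by rewrite -{1}conjc1 (inj_eq (can_inj (@conjcK _))) (negPf xiy).
Qed.

Definition twist u eta (x : G) : R := complex.Re (u * (eta x)^*).

Lemma twist_norm_le u eta x : `|u| = 1 -> `|twist u eta x| <= 1.
Proof.
move=> u1; rewrite -lecR (le_trans (normc_ge_Re _))//.
by rewrite normrM u1 normcJ norm_char mulr1.
Qed.

(** Used with [S] the whole group, where means must not change, and with [S = A], where the weights
    must split. *)
Lemma avg_twist S g u eta c :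
  'E_(x in S) (g x * (1 + c * twist u eta x))
    = avg S g + c * complex.Re (u * 'E_(x in S) ((g x)%:C * (eta x)^*)).
Proof.
rewrite -avgZ Re_avg -avgZ -avgD; apply: eq_avg => x.
rewrite mulrCA [_%:C * _]mulrC ReMr /twist; ring.
Qed.

(** The real part is half the sum of a multiple of [eta] and its conjugate, and each of these shifts
    the frequency by [eta] in one direction. *)
Lemma fourier_twist g u eta c xi :
  fourier (fun x => (g x * (1 + c * twist u eta x))%:C) xi
    = fourier (fun x => (g x)%:C) xi
      + (c%:C * u / 2 * fourier (fun x => (g x)%:C) (xi + eta)
         + c%:C * u^* / 2 * fourier (fun x => (g x)%:C) (xi - eta)).
Proof.
rewrite /fourier -!avgZ -!avgD; apply: eq_avg => x.
have -> : (g x * (1 + c * twist u eta x))%:C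
    = (g x)%:C * (1 + c%:C * ((u * (eta x)^* + u^* * eta x) / 2)).
  by rewrite rmorphM rmorphD rmorph1 rmorphM /twist /= ReJ_add rmorphM /= conjcK.
by rewrite /= !ffunE -(conj_char eta x) !rmorphM /= conjCK; field.
Qed.

Lemma sign_coefs_sub D D' (e : dual_group G R -> int) :
  {subset D <= D'} -> sign_coefs D' e -> sign_coefs D e.
Proof. by move=> sub ce l /sub; apply: ce. Qed.

Lemma sign_spanU1 D eta (k : int) xi : k \in [:: -1; 0; 1] -> eta \notin D ->
  sign_span D xi -> sign_span (eta |` D)%fset (eta *~ k + xi).
Proof.
move=> k3 etaD [e ce ->].
exists (fun l => if l == eta then k else e l) => [l|].
  by rewrite in_fset1U; case: eqP => //= _; apply: ce.
rewrite big_fsetU1//= eqxx; congr (_ + _); rewrite !big_seq.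
by apply: eq_bigr => l lD; case: eqP => // leta; rewrite -leta lD in etaD.
Qed.

Lemma sign_span0 D : sign_span D 0.
Proof. by exists (fun=> 0) => [l _ //|]; rewrite big1. Qed.

Lemma sign_spanN D xi : sign_span D xi -> sign_span D (- xi).
Proof.
move=> [e ce ->]; exists (fun l => - e l) => [l /ce|].
  by rewrite !inE => /or3P[] /eqP ->.
by rewrite -sumrN; apply: eq_bigr => l _; rewrite mulrNz.
Qed.

Lemma sign_span_mem D xi : xi \in D -> sign_span D xi.
Proof.
move=> xiD; exists (fun l => if l == xi then 1 else 0) => [l _|].
  by case: eqP.
rewrite (big_fsetD1 xi)//= eqxx big_seq big1 ?addr0// => l.
by rewrite in_fsetD1 => /andP[/negPf ->].
Qed.

(** A coefficient 1 or -1 at [eta] in a relation would put [eta] in the span of [D], which is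
    symmetric; with coefficient 0 the relation lives on [D]. *)
Lemma dissociatedU1 D eta :
  dissociated D -> ~ sign_span D eta -> dissociated (eta |` D)%fset.
Proof.
move=> dD etaD; have etaND : eta \notin D by apply/negP => /sign_span_mem.
move=> e ce; rewrite big_fsetU1//= => sum0.
have ceD : sign_coefs D e by apply: sign_coefs_sub ce => l lD; rewrite in_fset1U lD orbT.
have spanD : sign_span D (\sum_(l <- D) l *~ e l) by exists e.
have : e eta \in [:: -1; 0; 1] by apply: ce; rewrite in_fset1U eqxx.
rewrite !inE => /or3P[] /eqP eeta.
- by case: etaD; move/eqP: sum0; rewrite eeta mulrN1z addrC subr_eq0 => /eqP <-.
- rewrite eeta mulr0z add0r in sum0.
  by move=> l; rewrite in_fset1U => /predU1P[-> //|]; apply: dD.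
- case: etaD; move/eqP: sum0; rewrite eeta mulr1z addr_eq0 => /eqP ->.
  exact: sign_spanN.
Qed.

End Characters.


(** * The greedy construction and its entropy *)

Section RieszSystems.
Variables (R : realType) (G : finZmodType) (A : {set G}).
Implicit Types (D : {fset dual_group G R}) (eta : dual_group G R).

(** The invariant of the construction: all that is claimed except the bound on [r] and (iii). *)
Definition riesz_system r D (g : signs r -> G -> R) : Prop :=
  [/\ dissociated D, #|` D|%fset = r, forall s x, 0 <= g s x,
      forall s, 'E_(x in [set: G]) g s x = 1
        /\ (fourier_supp (fun x => (g s x)%:C) `<=` sign_span D)%classic &
      forall x, 'E_(s in [set: signs r]) g s x = 1].

Definition entropy r (g : signs r -> G -> R) : R :=
  'E_(s in [set: signs r]) (avg A (g s) * ln (avg A (g s))).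

Lemma riesz_system0 : riesz_system 0 fset0 (fun _ _ => 1).
Proof.
have G_gt0 : (0 < #|[set: G]|)%N by apply/card_gt0P; exists 0; rewrite inE.
split=> //= [s|x].
- split; first by rewrite avg_cst.
  by move=> xi /= /fourier_cst1 ->; apply: sign_span0.
- by rewrite avg_cst ?card_signs_gt0.
Qed.

Lemma entropy_le r D (g : signs r -> G -> R) :
  (0 < #|A|)%N -> riesz_system r D g -> entropy r g <= ln (#|G|%:R / #|A|%:R).
Proof.
move=> A_gt0 [_ _ g_ge0 gG gs].
have G_gt0 : 0 < #|G|%:R :> R by rewrite ltr0n; apply/card_gt0P; exists 0.
have A_gt0' : 0 < #|A|%:R :> R by rewrite ltr0n.
(* This is (ii) averaged over [A]. *)
have w1 : 'E_(s in [set: signs r]) avg A (g s) = 1.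
  by rewrite avg_exchange (eq_avg _ _ _ gs) avg_cst.
rewrite -[leRHS]mulr1 -[X in _ * X]w1 -avgZ.
apply: le_avg => s _; rewrite mulrC.
have w_ge0 : 0 <= avg A (g s) by apply: avg_ge0 => x _.
(* Zero weights are set aside, since comparing logarithms needs positive arguments. *)
have [<-|w_gt0] := eqVneq 0 (avg A (g s)); first by rewrite !mulr0.
rewrite ler_wpM2r// ler_ln ?posrE; last first.
- by rewrite divr_gt0.
- by rewrite lt_def eq_sym w_gt0.
have [/eqP] := gG s.
rewrite /avg cardsT ler_pM2r ?invr_gt0// => /eqP /(canRL (divfK (lt0r_neq0 G_gt0))).
rewrite mul1r => <- _; under [leRHS]eq_bigl do rewrite inE.
by rewrite [leRHS](bigID (mem A))/= lerDl sumr_ge0.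
Qed.

Lemma riesz_system_extend (e : R) r D (g : signs r -> G -> R) eta :
    (0 < #|A|)%N -> 0 <= e -> riesz_system r D g -> ~ sign_span D eta ->
    e%:C < 'E_(s in [set: signs r]) `| 'E_(x in A) ((g s x)%:C * (eta x)^*) | ->
  exists D' g', riesz_system r.+1 D' g' /\ entropy r g + e ^+ 2 / 2 <= entropy r.+1 g'.
Proof.
move=> A_gt0 e_ge0 [dD cD g_ge0 gG gs] etaD.
have etaND : eta \notin D by apply/negP => /sign_span_mem.
pose c s : R[i] := 'E_(x in A) ((g s x)%:C * (eta x)^*).
(* Where [c s] vanishes any phase works; 1 keeps [u s] unimodular. *)
pose u s : R[i] := if c s == 0 then 1 else `|c s| / c s.
have u1 s : `|u s| = 1.
  rewrite /u; case: eqP => [|/eqP cs0]; first by rewrite normr1.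
  by rewrite normrM normfV normr_id divff ?normr_eq0.
pose m s := complex.Re `|c s|.
have mE s : `|c s| = (m s)%:C by rewrite /m RRe_real ?normr_real.
have m_ge0 s : 0 <= m s by rewrite -ler0c -mE normr_ge0.
have ucE s : complex.Re (u s * c s) = m s.
  rewrite /u /m; case: eqP => [->|/eqP cs0]; first by rewrite mulr0 normr0.
  by rewrite divfK.
rewrite (eq_avg _ _ _ mE) -avg_real ltcR => e_lt.
pose h s (b : bool) x := g s x * (1 + (-1) ^+ b * twist _ _ (u s) eta x).
have h_ge0 s b x : 0 <= h s b x.
  rewrite mulr_ge0//; have := twist_norm_le _ _ (u s) eta x (u1 s).
  by rewrite ler_norml => /andP[]; case: b; rewrite ?expr1 ?expr0; lra.
have hA s b : avg A (h s b) = avg A (g s) + (-1) ^+ b * m s.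
  by rewrite avg_twist ucE.
(* Nonnegativity of the half with the minus sign gives the range that [xlnx_split] requires. *)
have w_ge s : m s <= avg A (g s).
  have : 0 <= avg A (h s true) by apply: avg_ge0 => x _.
  by rewrite hA expr1; lra.
exists (eta |` D)%fset, (fun s => h (signs_behead r s) (s ord0)); split.
  split.
  - exact: dissociatedU1.
  - by rewrite cardfsU1 etaND cD.
  - by move=> s x; apply: h_ge0.
  - move=> s; move: (signs_behead r s) (s ord0) => {}s b; have [gs1 gsupp] := gG s.
    split.
      rewrite avg_twist gs1 -[avg _ _]/(fourier (fun x => (g s x)%:C) eta).
      (* As [eta] is outside the span of [D], its coefficient in [g s] vanishes and the mean stays
         1. *)
      have [->|/gsupp//] := eqVneq (fourier (fun x => (g s x)%:C) eta) 0.
      by rewrite mulr0 mulr0 addr0.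
    move=> xi; rewrite /fourier_supp /= fourier_twist => nz.
    (* A nonzero coefficient at [xi] forces one at [xi], [xi + eta] or [xi - eta] for [g s]; each
       case adds a multiple [k] of [eta] to an element of the old span. *)
    have step k : k \in [:: -1; 0; 1] ->
        fourier (fun x => (g s x)%:C) (xi - eta *~ k) != 0 ->
        sign_span (eta |` D)%fset xi.
      by move=> k3 /gsupp /(sign_spanU1 _ _ _ _ _ _ k3 etaND); rewrite addrC subrK.
    have [f0|] := eqVneq (fourier (fun x => (g s x)%:C) xi) 0; last first.
      by move=> f0; apply: (step 0) => //; rewrite mulr0z subr0.
    have [f1|] := eqVneq (fourier (fun x => (g s x)%:C) (xi + eta)) 0; last first.
      by move=> f1; apply: (step (-1)) => //; rewrite mulrN1z opprK.
    have [f2|] := eqVneq (fourier (fun x => (g s x)%:C) (xi - eta)) 0; last first.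
      by move=> f2; apply: (step 1).
    by rewrite f0 f1 f2 !mulr0 !addr0 eqxx in nz.
  - move=> x; rewrite (@avg_signsS _ r (fun s b => h s b x)) -[RHS](gs x).
    by apply: eq_avg => s; rewrite /h expr0 expr1; field.
have w1 : 'E_(s in [set: signs r]) avg A (g s) = 1.
  by rewrite avg_exchange (eq_avg _ _ _ gs) avg_cst.
rewrite /entropy.
rewrite (@avg_signsS _ r (fun s b => avg A (h s b) * ln (avg A (h s b)))).
(* The mean of [m] exceeds [e], so [e] times it, less [e ^+ 2 / 2], is at least [e ^+ 2 / 2]. *)
have gain : 0 <= e * (avg [set: signs r] m - e) by rewrite mulr_ge0// subr_ge0 ltW.
set Phi := 'E_(s in _) _.
suff : Phi + e * avg [set: signs r] m + (- (e ^+ 2 / 2)) * 1 <=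
   'E_(s in [set: signs r]) ((avg A (h s false) * ln (avg A (h s false))
      + avg A (h s true) * ln (avg A (h s true))) / 2).
  by apply: le_trans; nra.
(* Writing the factor 1 as the mean of the weights reduces the claim to [xlnx_split] for each
   [s]. *)
rewrite -[X in _ + _ * X <= _]w1 -!avgZ -!avgD; apply: le_avg => s _.
rewrite !hA expr0 expr1 mul1r mulN1r.
have /(xlnx_split _ _ _ _ e_ge0) : 0 <= m s <= avg A (g s) by rewrite m_ge0 w_ge.
by lra.
Qed.

(** If no stage were final, the extension could be repeated forever and the entropy would pass its
    upper bound. *)
Lemma riesz_system_greedy (e : R) : (0 < #|A|)%N -> 0 < e ->
  exists r D g, [/\ riesz_system r D g,
    r%:R * (e ^+ 2 / 2) <= ln (#|G|%:R / #|A|%:R) &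
    forall eta, ~ sign_span D eta ->
      'E_(s in [set: signs r]) `| 'E_(x in A) ((g s x)%:C * (eta x)^*) | <= e%:C].
Proof.
move=> A_gt0 e_gt0; apply: contrapT => none.
have growth n : exists D g, riesz_system n D g /\ n%:R * (e ^+ 2 / 2) <= entropy n g.
  elim: n => [|n [D [g [gD gE]]]].
    exists fset0, (fun _ _ => 1); split; first exact: riesz_system0.
    rewrite mul0r /entropy (eq_avg _ _ (fun=> 0)) => [|s].
      by rewrite avg_cst ?card_signs_gt0.
    by rewrite avg_cst// ln1 mulr0.
  have [[eta [etaD eta_gt]]|small] := pselect (exists eta, ~ sign_span D eta /\
      e%:C < 'E_(s in [set: signs n]) `| 'E_(x in A) ((g s x)%:C * (eta x)^*) |).
    have [D' [g' [gD' gE']]] := riesz_system_extend _ _ _ _ _ A_gt0 (ltW e_gt0) gD etaD eta_gt.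
    by exists D', g'; split=> //; rewrite (le_trans _ gE')// -natr1; lra.
  case: none; exists n, D, g; split=> // [|eta etaD].
    by rewrite (le_trans gE)// (entropy_le _ D).
  (* The order on [R[i]] is partial, so both sides must be shown real. *)
  rewrite real_leNgt; first by apply/negP => lt; case: small; exists eta.
  - by rewrite ger0_real// avg_ge0.
  - by apply/complex_realP; exists e.
(* The successor makes [n] strictly larger than the quotient, one stage too many. *)
pose n := (Num.truncn (ln (#|G|%:R / #|A|%:R) / (e ^+ 2 / 2))).+1.
have e2_gt0 : 0 < e ^+ 2 / 2 by rewrite divr_gt0 ?exprn_gt0.
have [D [g [gD gE]]] := growth n.
have := le_trans gE (entropy_le _ _ _ A_gt0 gD).
by rewrite -ler_pdivlMr// leNgt truncnS_gt.
Qed.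

End RieszSystems.

Theorem theorem4p2 (R : realType) (G : finZmodType) (A : {set G})
    (alpha epsilon : R)
    (alphaE : alpha = #|A|%:R / #|G|%:R) (alpha_gt0 : 0 < alpha)
    (epsilon_gt0 : 0 < epsilon) (epsilon_lt1 : epsilon < 1) :
  exists (r : nat) (D : {fset dual_group G R}) (g : signs r -> G -> R),
    [/\ r%:R <= 2 / epsilon ^+ 2 * ln (1 / alpha),
        dissociated D,
        #|` D| = r &
        forall s x, 0 <= g s x] /\
    [/\ forall s : signs r,
          'E_(x in [set: G]) g s x = 1 /\
          (fourier_supp (fun x => (g s x)%:C) `<=` sign_span D)%classic,
        forall x : G, 'E_(s in [set: signs r]) g s x = 1 &
        forall eta : dual_group G R, ~ sign_span D eta ->
          'E_(s in [set: signs r]) `| 'E_(x in A) ((g s x)%:C * (eta x)^*) |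
            <= epsilon%:C].
Proof.
have G_gt0 : 0 < #|G|%:R :> R by rewrite ltr0n; apply/card_gt0P; exists 0.
have A_gt0 : (0 < #|A|)%N.
  by rewrite -(ltr0n R) -(divfK (lt0r_neq0 G_gt0) #|A|%:R) -alphaE mulr_gt0.
have [r [D [g [[dD cD g_ge0 gG gs] rE small]]]] := riesz_system_greedy _ _ A _ A_gt0 epsilon_gt0.
exists r, D, g; split; split=> //.
(* Here [1 / alpha] is [#|G| / #|A|], and dividing by [epsilon ^+ 2 / 2] gives the constant. *)
rewrite alphaE mul1r invf_div mulrC -[2 / _]invf_div ler_pdivlMr//.
by rewrite divr_gt0 ?exprn_gt0.
Qed.
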